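(* Let $m,n,s,k$ be four integers such that $2\leq s\leq n$, $2\leq k\leq m$ and $ms=nk$. Set $d=\gcd(s,k)$. Then: (i) if there exists a diagonal $\mathrm{SMA}\left(\frac{nk}{d};d\right)$, then there exists an $\mathrm{SMA}(m,n;s,k)$; (ii) if there exists a shiftable diagonal $\mathrm{SMA}\left(\frac{nk}{d};d\right)$, then there exists a shiftable $\mathrm{SMA}(m,n;s,k)$; (iii) if there exists a diagonal $\mathrm{MR}\left(\frac{nk}{d};d\right)$, then there exists an $\mathrm{MR}(m,n;s,k)$.
   Context: A partially filled (pf) array is a matrix some of whose cells may be empty; row and column sums are taken over the filled cells. A signed magic array $\mathrm{SMA}(m,n;s,k)$ is an $m\times n$ pf array with entries in $\Omega\subset\mathbb{Z}$, where $\Omega=\{0,\pm1,\ldots,\pm(nk-1)/2\}$ if $nk$ is odd and $\Omega=\{\pm1,\ldots,\pm nk/2\}$ if $nk$ is even, such that: (a) each row contains exactly $s$ filled cells and each column exactly $k$ filled cells; (b) every $x\in\Omega$ appears exactly once; (c) the elements in every row and column sum to $0$. A magic rectangle $\mathrm{MR}(m,n;s,k)$ is an $m\times n$ pf array with entries in $\Omega=\{0,1,\ldots,nk-1\}$ such that: (a) each row contains exactly $s$ filled cells and each column exactly $k$ filled cells; (b) every $x\in\Omega$ appears exactly once; (c) all row sums equal a constant $c_1$ and all column sums equal a constant $c_2$. $\mathrm{SMA}(a;b)$ and $\mathrm{MR}(a;b)$ denote $\mathrm{SMA}(a,a;b,b)$ and $\mathrm{MR}(a,a;b,b)$. For a square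 pf array of size $a$ with rows and columns indexed by $\{1,\ldots,a\}$, the cell $(i,j)$ belongs to the diagonal $D_r$ if $j-i\equiv r\pmod a$. An $\mathrm{SMA}(a;b)$ or $\mathrm{MR}(a;b)$ is diagonal if its filled cells are exactly those of $b$ consecutive diagonals $D_r,\ldots,D_{r+b-1}$ (indices modulo $a$). A pf array with entries in $\mathbb{Z}$ is shiftable if every row and every column contains an equal number of positive and negative entries. *)

(* Defs.v *)
From mathcomp Require Import all_boot all_order all_algebra.
Set Implicit Arguments.
Unset Strict Implicit.
Unset Printing Implicit Defensive.
Import Order.TTheory GRing.Theory Num.Theory.
Local Open Scope ring_scope.

(* [None] is an empty cell. Rows and columns are numbered from 0. *)
Definition pf_array (m n : nat) := 'M[option int]_(m, n).

Definition filled m n (A : pf_array m n) (i : 'I_m) (j : 'I_n) : bool :=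
  isSome (A i j).

Definition row_sum m n (A : pf_array m n) (i : 'I_m) : int :=
  \sum_(j < n) odflt 0 (A i j).

Definition col_sum m n (A : pf_array m n) (j : 'I_n) : int :=
  \sum_(i < m) odflt 0 (A i j).

Definition filled_counts m n (s k : nat) (A : pf_array m n) : Prop :=
  (forall i : 'I_m, #|[set j : 'I_n | filled A i j]| = s) /\
  (forall j : 'I_n, #|[set i : 'I_m | filled A i j]| = k).

Definition entries_in m n (Omega : {pred int}) (A : pf_array m n) : Prop :=
  forall (i : 'I_m) (j : 'I_n) (x : int), A i j = Some x -> x \in Omega.

Definition each_once m n (Omega : {pred int}) (A : pf_array m n) : Prop :=
  forall x : int, x \in Omega ->
    #|[set c : 'I_m * 'I_n | A c.1 c.2 == Some x]| = 1%N.

(* {0, +-1, ..., +-(N-1)/2} if N is odd, {+-1, ..., +-N/2} if N is even. *)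
Definition Omega_SMA (N : nat) : {pred int} :=
  [pred x : int | if odd N then (`|x| <= N.-1./2)%N
                  else (x != 0) && (`|x| <= N./2)%N].

Definition Omega_MR (N : nat) : {pred int} :=
  [pred x : int | 0 <= x <= N%:Z - 1].

Definition is_SMA m n (s k : nat) (A : pf_array m n) : Prop :=
  [/\ entries_in (Omega_SMA (n * k)) A,
      filled_counts s k A,
      each_once (Omega_SMA (n * k)) A,
      (forall i : 'I_m, row_sum A i = 0)
    & (forall j : 'I_n, col_sum A j = 0)].

Definition is_MR m n (s k : nat) (A : pf_array m n) : Prop :=
  [/\ entries_in (Omega_MR (n * k)) A,
      filled_counts s k A,
      each_once (Omega_MR (n * k)) A,
      (exists c1 : int, forall i : 'I_m, row_sum A i = c1)
    & (exists c2 : int, forall j : 'I_n, col_sum A j = c2)].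

(* Only j - i matters, so numbering rows and columns from 0 instead of 1 does
   not change the diagonals. *)
Definition on_diag a (r : int) (i j : 'I_a) : bool :=
  (j%:Z - i%:Z == r %[mod a])%Z.

Definition is_diagonal a (b : nat) (A : pf_array a a) : Prop :=
  exists r : int, forall i j : 'I_a,
    filled A i j <-> exists2 t : nat, (t < b)%N & on_diag (r + t%:Z) i j.

Definition pos_cell (c : option int) : bool := if c is Some x then 0 < x else false.
Definition neg_cell (c : option int) : bool := if c is Some x then x < 0 else false.

Definition shiftable m n (A : pf_array m n) : Prop :=
  (forall i : 'I_m, #|[set j : 'I_n | pos_cell (A i j)]|
                    = #|[set j : 'I_n | neg_cell (A i j)]|) /\
  (forall j : 'I_n, #|[set i : 'I_m | pos_cell (A i j)]|
                    = #|[set i : 'I_m | neg_cell (A i j)]|).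

(* Main.v *)
Require Import Defs.
From mathcomp Require Import all_boot all_order all_algebra.
From mathcomp Require Import zify.

(** Write [s = s1 d], [k = k1 d] with [s1], [k1] coprime. Then [m = c k1],
    [n = c s1] and [a = c k1 s1 = lcm (m, n)] for some [c >= d]. Reduce the row
    indices of the diagonal array of size [a] modulo [m] and its column indices
    modulo [n]. No two filled cells collide: if [(i, j)] and [(i', j')] do, then
    [j - i] and [j' - i'] agree modulo [c]; both lie in a window of [d <= c]
    consecutive diagonals, so they agree modulo [a], whence [i - i'] and
    [j - j'] agree modulo [a] and are divisible by [lcm (m, n) = a]. Each row of
    the folded array thus collects the entries of [s1] rows, and each column
    those of [k1] columns. *)

Set Implicit Arguments.
Unset Strict Implicit.
Unset Printing Implicit Defensive.
Import Order.TTheory GRing.Theory Num.Theory.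

(** * Folding an array along two index maps *)

Section Fold.

Variables (p q m n : nat) (f : 'I_p -> 'I_m) (g : 'I_q -> 'I_n).
Variable A : pf_array p q.

(** Under [fold_inj] at most one filled cell lies over [(i, j)], so the choice made by [pick] is
    then forced. *)
Definition fold_array : pf_array m n :=
  (\matrix_(i, j)
     if [pick c : 'I_p * 'I_q | [&& f c.1 == i, g c.2 == j & filled A c.1 c.2]]
        is Some c then A c.1 c.2 else None)%R.

Hypothesis fold_inj : forall i j i' j', filled A i j -> filled A i' j' ->
  f i = f i' -> g j = g j' -> (i, j) = (i', j').

Section Big.

Variables (V : Type) (idx : V) (op : Monoid.com_law idx) (F : option int -> V).
Hypothesis F_None : F None = idx.

(** Every cell of the fibre other than the unique filled one contributes [F None = idx]. A general
    [F] and [op] let sums of entries and counts of cells be treated alike. *)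
Lemma fold_arrayE i j :
  F (fold_array i j) =
  \big[op/idx]_(c : 'I_p * 'I_q | (f c.1 == i) && (g c.2 == j)) F (A c.1 c.2).
Proof.
rewrite mxE; case: pickP => [c /and3P[/eqP fc /eqP gc Ac]|noc].
  rewrite (bigD1 c) /= ?fc ?gc ?eqxx // big1 ?Monoid.mulm1 // => e.
  case/andP=> /andP[/eqP fe /eqP ge] nec.
  case Ae: (A e.1 e.2) => [x|]; last by rewrite F_None.
  have fillede : filled A e.1 e.2 by rewrite /filled Ae.
  case/negP: nec; apply/eqP; rewrite [e]surjective_pairing [c]surjective_pairing.
  by apply: fold_inj; rewrite ?fe ?ge.
rewrite big1 ?F_None // => c /andP[fc gc].
move: (noc c); rewrite fc gc /= /filled.
by case: (A c.1 c.2) => //; rewrite F_None.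
Qed.

Lemma big_fold_row i :
  \big[op/idx]_j F (fold_array i j) =
  \big[op/idx]_(i' | f i' == i) \big[op/idx]_j F (A i' j).
Proof.
rewrite pair_big /= (partition_big (fun c : 'I_p * 'I_q => g c.2) xpredT) //=.
by apply: eq_bigr => j _; rewrite fold_arrayE; apply: eq_bigl => c; rewrite andbT.
Qed.

Lemma big_fold_col j :
  \big[op/idx]_i F (fold_array i j) =
  \big[op/idx]_(j' | g j' == j) \big[op/idx]_i F (A i j').
Proof.
rewrite exchange_big pair_big.
rewrite (partition_big (fun c : 'I_p * 'I_q => f c.1) xpredT) //=.
by apply: eq_bigr => i _; rewrite fold_arrayE; apply: eq_bigl => c; rewrite andbC.
Qed.

Lemma big_fold :
  \big[op/idx]_i \big[op/idx]_j F (fold_array i j) =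
  \big[op/idx]_i \big[op/idx]_j F (A i j).
Proof.
under eq_bigr => i _ do rewrite big_fold_row.
by rewrite (partition_big f xpredT).
Qed.

End Big.

Lemma card_set_sum (T : finType) (P : pred T) : #|[set x | P x]| = \sum_x P x.
Proof. by rewrite -sum1dep_card big_mkcond. Qed.

(** Counting is summing the 0/1 values of [P]; failure at [None] makes empty cells contribute the
    neutral element 0. *)
Lemma card_fold_row (P : pred (option int)) i : ~~ P None ->
  #|[set j | P (fold_array i j)]| =
  \sum_(i' | f i' == i) #|[set j | P (A i' j)]|.
Proof.
move=> /negbTE PN; rewrite card_set_sum (big_fold_row _ (F := fun o => P o : nat)) ?PN //.
by apply: eq_bigr => i' _; rewrite card_set_sum.
Qed.

Lemma card_fold_col (P : pred (option int)) j : ~~ P None ->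
  #|[set i | P (fold_array i j)]| =
  \sum_(j' | g j' == j) #|[set i | P (A i j')]|.
Proof.
move=> /negbTE PN; rewrite card_set_sum (big_fold_col _ (F := fun o => P o : nat)) ?PN //.
by apply: eq_bigr => j' _; rewrite card_set_sum.
Qed.

Lemma fold_entries_in Omega : entries_in Omega A -> entries_in Omega fold_array.
Proof.
by move=> AO i j x; rewrite mxE; case: pickP => // c _; apply: AO.
Qed.

(** The number of occurrences of [x] is a double sum of indicators over all cells, and folding
    preserves such sums. *)
Lemma fold_each_once Omega : each_once Omega A -> each_once Omega fold_array.
Proof.
move=> AO x /AO; rewrite !card_set_sum.
rewrite -(pair_big xpredT xpredT (fun i j => (A i j == Some x : nat))) /=.
rewrite -(pair_big xpredT xpredT (fun i j => (fold_array i j == Some x : nat))).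
by rewrite /= (big_fold _ (F := fun o => o == Some x : nat)).
Qed.

Lemma fold_shiftable : shiftable A -> shiftable fold_array.
Proof.
case=> Ar Ac; split=> [i|j].
  by rewrite !card_fold_row //; apply: eq_bigr => i' _; apply: Ar.
by rewrite !card_fold_col //; apply: eq_bigr => j' _; apply: Ac.
Qed.

(** Common fibre sizes: [u] rows of [A] merge into each row of the fold, and [v] columns into each
    column. *)
Variables u v : nat.
Hypothesis card_f : forall i, #|[pred i' | f i' == i]| = u.
Hypothesis card_g : forall j, #|[pred j' | g j' == j]| = v.

Lemma fold_filled_counts s k :
  filled_counts s k A -> filled_counts (u * s) (v * k) fold_array.
Proof.
rewrite /filled_counts /filled => -[Ar Ac]; split=> [i|j].
  rewrite (card_fold_row (P := isSome)) // (eq_bigr (fun=> s)) //.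
  by rewrite sum_nat_const card_f.
rewrite (card_fold_col (P := isSome)) // (eq_bigr (fun=> k)) //.
by rewrite sum_nat_const card_g.
Qed.

Lemma fold_row_sum c i :
  (forall i', row_sum A i' = c) -> row_sum fold_array i = (c *+ u)%R.
Proof.
move=> Ac; rewrite /row_sum (big_fold_row _ (F := odflt 0%R)) //.
by rewrite (eq_bigr (fun=> c)) ?sumr_const ?card_f // => i' _; apply: Ac.
Qed.

Lemma fold_col_sum c j :
  (forall j', col_sum A j' = c) -> col_sum fold_array j = (c *+ v)%R.
Proof.
move=> Ac; rewrite /col_sum (big_fold_col _ (F := odflt 0%R)) //.
by rewrite (eq_bigr (fun=> c)) ?sumr_const ?card_g // => j' _; apply: Ac.
Qed.

(** The numerical hypothesis says that both arrays have the same number of entries, hence the same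
    [Omega_SMA]. *)
Lemma fold_SMA s k : q * k = n * (v * k) ->
  is_SMA s k A -> is_SMA (u * s) (v * k) fold_array.
Proof.
move=> qk [AO Afc A1 Ar Ac]; split; rewrite -?qk.
- exact: fold_entries_in.
- exact: fold_filled_counts.
- exact: fold_each_once.
- by move=> i; rewrite (fold_row_sum i Ar) mul0rn.
- by move=> j; rewrite (fold_col_sum j Ac) mul0rn.
Qed.

Lemma fold_MR s k : q * k = n * (v * k) ->
  is_MR s k A -> is_MR (u * s) (v * k) fold_array.
Proof.
move=> qk [AO Afc A1 [c1 Ar] [c2 Ac]]; split; rewrite -?qk.
- exact: fold_entries_in.
- exact: fold_filled_counts.
- exact: fold_each_once.
- by exists (c1 *+ u)%R => i; apply: fold_row_sum.
- by exists (c2 *+ v)%R => j; apply: fold_col_sum.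
Qed.

End Fold.

(** * Reduction of indices modulo a divisor *)

Definition ord_mod a b (b_gt0 : 0 < b) (i : 'I_a) : 'I_b :=
  Ordinal (ltn_pmod i b_gt0).

Lemma card_ord_mod a b c (b_gt0 : 0 < b) (i : 'I_b) : a = c * b ->
  #|[pred i' : 'I_a | ord_mod b_gt0 i' == i]| = c.
Proof.
move=> ->.
have lt_h (x : 'I_c) : x * b + i < c * b.
  by have := ltn_ord x; have := ltn_ord i; nia.
(* The fibre over [i] is enumerated by [x * b + i] for [x < c]. *)
pose h x := Ordinal (lt_h x).
have h_inj : injective h.
  by move=> x y [] /addIn /eqP; rewrite eqn_pmul2r // => /eqP /val_inj.
rewrite -[RHS]card_ord -(card_imset predT h_inj); apply: eq_card => y.
rewrite !inE; apply/eqP/imsetP => [y_i|[x _ ->]].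
  have lt_y : y %/ b < c by rewrite ltn_divLR.
  by exists (Ordinal lt_y) => //; apply: val_inj; rewrite /= -y_i -divn_eq.
by apply: val_inj; rewrite /= modnMDl modn_small.
Qed.

(** * Index differences and absence of collisions *)

Lemma dvdz_ord_mod a b (b_gt0 : 0 < b) (i i' : 'I_a) :
  ord_mod b_gt0 i = ord_mod b_gt0 i' -> (b %| (i%:Z - i'%:Z)%R)%Z.
Proof. by case=> eq_mod; rewrite -eqz_mod_dvd !modz_nat eq_mod. Qed.

Lemma dvdz_sub_small (a x y : nat) :
  x < a -> y < a -> (a %| (x%:Z - y%:Z)%R)%Z -> x = y.
Proof. by move=> xa ya; rewrite -eqz_mod_dvd !modz_small // => /eqP[]. Qed.

(** Write [x = z * (c * k1)]. For nonzero [c], cancelling it leaves [s1] dividing [z * k1], so [s1]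
    divides [z] by Gauss. *)
Lemma dvdz_coprime_mul (x c k1 s1 : int) : coprimez k1 s1 ->
  ((c * k1)%R %| x)%Z -> ((c * s1)%R %| x)%Z -> ((c * k1 * s1)%R %| x)%Z.
Proof.
move=> co /dvdzP[z ->]; have [->|c0] := eqVneq c 0%R; first by rewrite !mul0r.
rewrite mulrCA !dvdz_mul2l -?mulrA ?dvdz_mul2l // => s1_zk1.
rewrite [(z * k1)%R]mulrC dvdz_mul // -(Gauss_dvdzl _ (p := k1)) //.
by rewrite coprimez_sym.
Qed.

Lemma diagonal_fold_inj (c k1 s1 d : nat) (m_gt0 : 0 < c * k1)
    (n_gt0 : 0 < c * s1) (A : pf_array (c * k1 * s1) (c * k1 * s1)) :
  coprime k1 s1 -> d <= c -> is_diagonal d A ->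
  forall i j i' j', filled A i j -> filled A i' j' ->
  ord_mod m_gt0 i = ord_mod m_gt0 i' -> ord_mod n_gt0 j = ord_mod n_gt0 j' ->
  (i, j) = (i', j').
Proof.
move=> co le_dc [r dA] i j i' j' /dA[t lt_td ij_t] /dA[t' lt_td' ij_t'].
move=> /dvdz_ord_mod m_i /dvdz_ord_mod n_j.
set a := c * k1 * s1 in A dA i j i' j' ij_t ij_t' m_i n_j *.
have m_a : ((c * k1)%:Z %| a%:Z)%Z by rewrite dvdzE /= dvdn_mulr.
have n_a : ((c * s1)%:Z %| a%:Z)%Z by rewrite dvdzE /= /a mulnAC dvdn_mulr.
have c_m : (c %| (c * k1)%:Z)%Z by rewrite dvdzE /= dvdn_mulr.
have c_n : (c %| (c * s1)%:Z)%Z by rewrite dvdzE /= dvdn_mulr.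
(* Subtracting the two diagonal congruences eliminates the unknown offset [r]. *)
have a_tt : (a %| ((j%:Z - j'%:Z) - (i%:Z - i'%:Z) - (t%:Z - t'%:Z))%R)%Z.
  move: ij_t ij_t'; rewrite /on_diag !eqz_mod_dvd => a_t a_t'.
  rewrite (_ : _ - _ = (j%:Z - i%:Z - (r + t%:Z)) -
    (j'%:Z - i'%:Z - (r + t'%:Z)))%R; last by lia.
  by rewrite rpredB.
(* Both index differences vanish modulo [c], hence so does [t - t'], while [t, t' < d <= c]. *)
have eq_tt' : t = t'.
  apply: (dvdz_sub_small (leq_trans lt_td le_dc) (leq_trans lt_td' le_dc)).
  rewrite -[(t%:Z - t'%:Z)%R](subKr ((j%:Z - j'%:Z) - (i%:Z - i'%:Z))%R).
  apply: rpredB (dvdz_trans (dvdz_trans c_m m_a) a_tt).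
  exact: rpredB (dvdz_trans c_n n_j) (dvdz_trans c_m m_i).
have a_ji : (a %| ((j%:Z - j'%:Z) - (i%:Z - i'%:Z))%R)%Z.
  by move: a_tt; rewrite eq_tt' subrr subr0.
(* [c * s1] divides [j - j'] by [n_j]; [c * k1] does too, since it divides both [i - i'] and [a]. *)
have a_j : (a %| (j%:Z - j'%:Z)%R)%Z.
  apply: (dvdz_coprime_mul (c := c) (k1 := k1) (s1 := s1)) => //.
  rewrite -[(j%:Z - j'%:Z)%R](subrK (i%:Z - i'%:Z)%R).
  by rewrite rpredD // (dvdz_trans m_a a_ji).
have a_i : (a %| (i%:Z - i'%:Z)%R)%Z.
  by rewrite -[(i%:Z - i'%:Z)%R](subKr (j%:Z - j'%:Z)%R) rpredB.
by congr (_, _); apply: val_inj;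
  [apply: dvdz_sub_small a_i | apply: dvdz_sub_small a_j].
Qed.

(** * Factoring the parameters and folding the diagonal array *)

Theorem theorem5p1 (m n s k : nat)
  (hs : 2 <= s <= n) (hk : 2 <= k <= m) (hms : m * s = n * k) :
  let d := gcdn s k in
  let a := (n * k) %/ d in
  [/\ (exists2 A : pf_array a a, is_SMA d d A & is_diagonal d A) ->
        exists B : pf_array m n, is_SMA s k B,
      (exists A : pf_array a a,
          [/\ is_SMA d d A, is_diagonal d A & shiftable A]) ->
        exists2 B : pf_array m n, is_SMA s k B & shiftable B
    & (exists2 A : pf_array a a, is_MR d d A & is_diagonal d A) ->
        exists B : pf_array m n, is_MR s k B].
Proof.
move=> d a.
have d_gt0 : 0 < d by rewrite gcdn_gt0; lia.
have [s1 s_eq] : exists s1, s = s1 * d by apply/dvdnP/dvdn_gcdl.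
have [k1 k_eq] : exists k1, k = k1 * d by apply/dvdnP/dvdn_gcdr.
have co : coprime k1 s1.
  rewrite /coprime gcdnC -(eqn_pmul2r d_gt0) muln_gcdl -s_eq -k_eq mul1n.
  exact: eqxx.
have ms1 : m * s1 = n * k1.
  by apply/eqP; rewrite -(eqn_pmul2r d_gt0) -!mulnA -s_eq -k_eq; apply/eqP.
(* [k1] divides [m * s1 = n * k1] and is coprime to [s1], so it divides [m]. *)
have [c m_eq] : exists c, m = c * k1.
  by apply/dvdnP; rewrite -(Gauss_dvdl _ co) ms1 dvdn_mull.
have k1_gt0 : 0 < k1 by nia.
have n_eq : n = c * s1.
  by apply/eqP; rewrite -(eqn_pmul2r k1_gt0) -ms1 m_eq mulnAC.
(* For instance, [k <= m] reads [k1 * d <= c * k1] with [k1] positive. *)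
have le_dc : d <= c by nia.
have a_eq : a = c * k1 * s1.
  by rewrite /a k_eq mulnA mulnK // n_eq mulnAC.
have m_gt0 : 0 < c * k1 by lia.
have n_gt0 : 0 < c * s1 by lia.
(* The array types depend on [a], [m] and [n], so these are first replaced by their products in [c],
   [k1] and [s1]. *)
move: {hs hk hms ms1} a a_eq; rewrite {}m_eq {}n_eq s_eq k_eq.
clearbody d => _ ->.
have card_f i := @card_ord_mod (c * k1 * s1) _ s1 m_gt0 i (mulnC _ _).
have an : c * k1 * s1 = k1 * (c * s1) by rewrite mulnAC mulnC.
have card_g i := @card_ord_mod _ _ k1 n_gt0 i an.
have qk : c * k1 * s1 * d = c * s1 * (k1 * d) by lia.
pose B (A : pf_array (c * k1 * s1) (c * k1 * s1)) :=
  fold_array (ord_mod m_gt0) (ord_mod n_gt0) A.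
split=> [[A SA dA]|[A [SA dA sA]]|[A MA dA]];
  have inj := diagonal_fold_inj (m_gt0 := m_gt0) (n_gt0 := n_gt0) co le_dc dA.
- by exists (B A); apply: fold_SMA.
- by exists (B A); [apply: fold_SMA | apply: fold_shiftable].
- by exists (B A); apply: fold_MR.
Qed.
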